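(* For every integer $n\ge 1$, the number of parking graphs on the vertex set $[n]=\{1,\dots,n\}$ is exactly $(n+1)^{n-1}$.
   Context: A mixed graph may contain both undirected and directed edges. A parking graph $P$ on $[n]$ is a mixed graph with vertex set $[n]$ in which every pair $\{j,k\}$ with $1\le j<k\le n$ is joined by exactly one edge, which is of exactly one of three types: a down edge $j\leftarrow k$ (directed from $k$ to $j$), an up edge $j\rightarrow k$ (directed from $j$ to $k$), or a downish edge $jk$ (undirected). Let $\vec P$ be the directed graph (a tournament on $[n]$) obtained from $P$ by keeping all directed edges and replacing every downish edge $jk$ ($j<k$) by the directed edge $j\leftarrow k$. $P$ must satisfy the source-sink condition: (i) $\vec P$ is acyclic (contains no directed cycle), and (ii) for every triangle (set of three vertices) of $P$ among whose three edges there is at least one down edge and at least one downish edge, the source (vertex of in-degree $0$ within the triangle in $\vec P$) and the sink (vertex of out-degree $0$ within the triangle in $\vec P$) are not joined by a downish edge in $P$. *)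

(* Defs.v *)
From HB Require Import structures.
From mathcomp Require Import all_boot.
Set Implicit Arguments. Unset Strict Implicit. Unset Printing Implicit Defensive.

(* Vertex set [n] is represented by 'I_n (vertex i+1 <-> ordinal i),
   preserving the order. *)
Inductive etype := Down | Up | Downish.

Definition etype_code (e : etype) : option bool :=
  match e with Down => None | Up => Some true | Downish => Some false end.
Definition etype_decode (o : option bool) : etype :=
  match o with None => Down | Some true => Up | Some false => Downish end.
Lemma etype_codeK : cancel etype_code etype_decode.
Proof. by case. Qed.
HB.instance Definition _ := Finite.copy etype (can_type etype_codeK).

(* A mixed graph on [n] with one edge per pair is encoded by a function
   f on ordered pairs; f (j,k) for j < k gives the type of the edge {j,k}.
   The values f (j,k) with j >= k are irrelevant, and are normalized to
   Down so that parking graphs correspond bijectively to such functions. *)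
Definition mgraph n := {ffun 'I_n * 'I_n -> etype}.

Definition normalized n (f : mgraph n) : bool :=
  [forall j : 'I_n, forall k : 'I_n, (k <= j)%N ==> (f (j, k) == Down)].

Definition ekind n (f : mgraph n) (u v : 'I_n) : etype :=
  if (u < v)%N then f (u, v) else f (v, u).

Definition arc n (f : mgraph n) : rel 'I_n := fun u v =>
  ((u < v)%N && (f (u, v) == Up)) || ((v < u)%N && (f (v, u) != Up)).

Definition acyclic n (f : mgraph n) : bool :=
  [forall x : 'I_n, forall y : 'I_n, arc f x y ==> ~~ connect (arc f) y x].

Definition triangle_ok n (f : mgraph n) : bool :=
  [forall a : 'I_n, forall b : 'I_n, forall c : 'I_n,
    [&& (a < b)%N, (b < c)%N,
        Down \in [:: f (a, b); f (a, c); f (b, c)] &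
        Downish \in [:: f (a, b); f (a, c); f (b, c)]] ==>
    [forall s : 'I_n, forall t : 'I_n,
      [&& s \in [:: a; b; c], t \in [:: a; b; c], s != t,
          all (fun x => ~~ arc f x s) [:: a; b; c] &
          all (fun x => ~~ arc f t x) [:: a; b; c]] ==>
      (ekind f s t != Downish)]].

Definition parking_graph n (f : mgraph n) : bool :=
  [&& normalized f, acyclic f & triangle_ok f].

(* Main.v *)
Require Import Defs.
From mathcomp Require Import all_boot zify.
Set Implicit Arguments. Unset Strict Implicit. Unset Printing Implicit Defensive.

(** An acyclic tournament is a linear order of the vertices, and the source-sink
    condition says that the downish edges form an order ideal in the set of
    inversions of that order, ordered by inclusion of intervals.  The maximal
    elements of this ideal are the arcs of a nonnesting partition of the
    positions whose blocks carry decreasing labels.  Sending a label to the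
    position at which its block starts gives a parking function, and the graph
    is recovered from it because nonnesting means that the positions which do
    not start a block are filled in first-in first-out order
    (Athanasiadis-Linusson).

    Parking functions are counted by choosing, for [i = 0, 1, ...], the set of
    labels with value [i].  If [m] labels remain and [k] assigned labels are
    still in excess, there are [(k + 1) (m + k + 1) ^ (m - 1)] ways to go on. *)

(** * Parking functions *)

(** The case [m = 0] stands for (k + 1) (k + 1)^(-1) = 1, which a natural exponent cannot
    express. *)
Definition parking_num (m k : nat) : nat :=
  if m is m'.+1 then k.+1 * (m + k).+1 ^ m' else 1.

(** Here [s] labels receive the current value. Of the [k + s] labels then available one fills the
    current position, whence the guard and the predecessor. *)
Lemma parking_num_rec (m k : nat) : 0 < m + k ->
  \sum_(s < m.+1 | 0 < k + s) 'C(m, s) * parking_num (m - s) (k + s).-1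
  = parking_num m k.
Proof.
(* The factor [m + k] turns each summand into C(m, s) (k + s) (m + k)^(m - s), which vanishes for
   [k + s = 0] and so absorbs the guard. *)
move=> mk_gt0; apply/eqP; rewrite -(eqn_pmul2l mk_gt0); apply/eqP.
rewrite big_mkcond big_distrr /=.
transitivity (\sum_(s < m.+1) 'C(m, s) * ((k + s) * (m + k) ^ (m - s))).
  apply: eq_bigr => s _; case: (posnP (k + s)) => [->|ks].
    by rewrite /= muln0 mul0n muln0.
  rewrite mulnCA; congr (_ * _); have := ltn_ord s; rewrite ltnS => sm.
  rewrite /parking_num; case E: (m - s) => [|r]; first by rewrite expn0; lia.
  have -> : (r.+1 + (k + s).-1).+1 = m + k by lia.
  by rewrite prednK // expnS; lia.
have sumk : \sum_(s < m.+1) 'C(m, s) * (k * (m + k) ^ (m - s))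
            = k * (m + k).+1 ^ m.
  rewrite -[(m + k).+1]addn1 expnDn big_distrr /=.
  by apply: eq_bigr => s _; rewrite exp1n muln1; lia.
(* Absorption: s C(m, s) = m C(m - 1, s - 1). *)
have sums : \sum_(s < m.+1) 'C(m, s) * (s * (m + k) ^ (m - s))
            = m * (m + k).+1 ^ m.-1.
  case: m {sumk mk_gt0} => [|m]; first by rewrite big_ord1 /= mul0n muln0.
  rewrite big_ord_recl /= mul0n muln0 add0n -[(m.+1 + k).+1]addn1 expnDn.
  rewrite big_distrr /=; apply: eq_bigr => s _.
  rewrite exp1n muln1 mulnA subSS /bump /= add1n.
  by rewrite [_ * s.+1]mulnC -mul_bin_diag -!mulnA.
rewrite (eq_bigr (fun s : 'I_m.+1 => 'C(m, s) * (k * (m + k) ^ (m - s))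
   + 'C(m, s) * (s * (m + k) ^ (m - s)))); last first.
  by move=> s _; rewrite mulnDl mulnDr.
(* What remains is k (m + k + 1) + m = (k + 1) (m + k). *)
rewrite big_split /= sumk sums /parking_num.
case: m {sumk sums} mk_gt0 => [|m] mk_gt0 /=; first by rewrite expn0; lia.
by rewrite expnS; nia.
Qed.

(** * Counting parking functions value by value *)

Section ParkingFunctions.

Variable n : nat.
Local Notation T := 'I_n.

(** The classical condition, shifted so that values start at 0. *)
Definition parking_function (a : {ffun T -> T}) : bool :=
  [forall i : T, i < #|[set v | a v <= i]|].

(* A state of the left-to-right exploration of the values [i, i+1, ...]: the
   labels outside [A] already have their value, and [k] of them are still
   available to fill positions from [i] on. *)
Definition parking_completions (i : nat) (A : {set T}) (k : nat)
    (a0 : {ffun T -> T}) : {set {ffun T -> T}} :=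
  [set a : {ffun T -> T} | [forall v, if v \in A then i <= a v else a v == a0 v]
    && [forall j : T, (i <= j) ==> (j - i < k + #|[set v in A | a v <= j]|)]].

(** Once [S] is fixed as the set of labels of value [i], the parking condition at [j = i] is
    [0 < k + #|S|]. For later [j] the counts split off [#|S|], and position [i] uses up one
    label. *)
Lemma parking_completions_fiber (i : T) (A S : {set T}) (k : nat)
    (a0 a : {ffun T -> T}) : S \subset A -> 0 < k + #|S| ->
  (a \in parking_completions i A k a0) && ([set v in A | a v == i] == S)
  = (a \in parking_completions i.+1 (A :\: S) (k + #|S|).-1
             [ffun v => if v \in S then i else a0 v]).
Proof.
move=> SA kS; rewrite !inE.
have cardE (j : T) : i <= j -> [set v in A | a v == i] = S ->
    #|[set v in A | a v <= j]| = #|S| + #|[set v in A :\: S | a v <= j]|.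
  move=> ij defS; rewrite -(cardsID S [set v in A | a v <= j]); congr (_ + _).
    apply: eq_card => v; rewrite !inE -defS !inE.
    case: eqP => [->|_]; rewrite ?andbT ?andbF ?ij //.
    by rewrite andbT andbb.
  by apply: eq_card => v; rewrite !inE; rewrite !andbA.
apply/idP/idP.
  case/andP=> /andP[/forallP dom /forallP cnt] /eqP defS; apply/andP; split.
    apply/forallP=> v; have := dom v.
    have vS : (v \in S) = (v \in A) && (a v == i) by rewrite -defS inE.
    rewrite !inE ffunE vS; case: (v \in A) => //=.
    case: eqP => [->|ne] //=; rewrite leq_eqVlt => /orP[/eqP e|//].
    by case: ne; apply: val_inj.
  apply/forallP=> j; apply/implyP=> ij; have := cnt j.
  by rewrite cardE // ?(ltnW ij) //= => /implyP; lia.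
case/andP=> /forallP dom /forallP cnt.
have defS : [set v in A | a v == i] = S.
  apply/setP=> v; have := dom v; rewrite !inE ffunE.
  case vS: (v \in S) => /=; first by rewrite (subsetP SA) // vS.
  case: (v \in A) => //= iv; by apply/eqP=> avi; rewrite avi ltnn in iv.
rewrite defS eqxx andbT; apply/andP; split.
  apply/forallP=> v; have := dom v; rewrite !inE ffunE.
  case vS: (v \in S) => /=; first by rewrite (subsetP SA) // => /eqP->.
  by case: (v \in A) => // /ltnW.
apply/forallP=> j; apply/implyP=> ij; rewrite cardE //.
move: (cnt j) kS; move: #|[set v in A :\: S | a v <= j]| #|S| => c s /implyP.
by case: (ltngtP i j) ij => // [ij _ /(_ isT)|<- _ _]; lia.
Qed.

(** Induction on the number [p] of values left; [#|A| + k = p] says that the labels at hand exactly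
    fill the remaining positions. *)
Lemma card_parking_completions (p i : nat) (A : {set T}) (k : nat)
    (a0 : {ffun T -> T}) : i + p = n -> #|A| + k = p ->
  #|parking_completions i A k a0| = parking_num #|A| k.
Proof.
elim: p i A k a0 => [|p IHp] i A k a0 ip Akp.
  have /eqP := Akp; rewrite addn_eq0 cards_eq0 => /andP[/eqP-> _].
  rewrite cards0 /= -(cards1 a0); apply: eq_card => a; rewrite !inE.
  apply/andP/eqP => [[/forallP dom _]|->].
    by apply/ffunP=> v; have := dom v; rewrite inE => /eqP.
  split; first by apply/forallP=> v; rewrite inE.
  by apply/forallP=> j; have := ltn_ord j; lia.
have lt_in : i < n by lia.
pose i0 := Ordinal lt_in.
rewrite -parking_num_rec; last by lia.
rewrite -sum1_card.
rewrite (partition_big (fun a : {ffun T -> T} => [set v in A | a v == i0])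
  (fun S : {set T} => (S \subset A) && (0 < k + #|S|))) /=; last first.
  move=> a; rewrite inE => /andP[/forallP dom /forallP cnt].
  apply/andP; split; first by apply/subsetP=> v; rewrite inE => /andP[].
  have := cnt i0; rewrite /= leqnn subnn /= => h; apply: leq_trans h _.
  rewrite leq_add2l; apply/subset_leq_card/subsetP=> v; rewrite !inE.
  case/andP=> vA avi; have := dom v; rewrite vA => iav.
  by apply/eqP/val_inj/anti_leq; rewrite avi.
transitivity (\sum_(S : {set T} | (S \subset A) && (0 < k + #|S|))
    parking_num (#|A| - #|S|) (k + #|S|).-1).
  apply: eq_bigr => S /andP[SA kS].
  rewrite sum1dep_card -(cardsDS SA).
  have ip' : i.+1 + p = n by lia.
  have card' : #|A :\: S| + (k + #|S|).-1 = p.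
    rewrite cardsDS //; move: (subset_leq_card SA) Akp kS; move: #|A| #|S| => x y.
    by lia.
  rewrite -(IHp _ _ _ [ffun v => if v \in S then i0 else a0 v] ip' card').
  apply: eq_card => a; rewrite -(parking_completions_fiber i0 a0 a SA kS).
  by rewrite [LHS]inE.
(* The summand depends on [S] only through its size, which [inord] places in the index type. *)
rewrite (partition_big (fun S : {set T} => inord #|S| : 'I_#|A|.+1)
  (fun s => 0 < k + s)) /=; last first.
  by move=> S /andP[/subset_leq_card SA]; rewrite inordK.
apply: eq_bigr => s ks.
rewrite -(cards_draws A s) -sum1_card big_distrl /=.
apply: eq_big => [S|S]; rewrite ?inE.
  case SA: (S \subset A) => //=.
  rewrite -(inj_eq val_inj) /= inordK ?ltnS ?subset_leq_card //.
  by case: eqP => [->|_]; rewrite ?andbT ?andbF.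
by case/andP=> /andP[SA _] /eqP <-; rewrite inordK ?ltnS ?subset_leq_card // mul1n.
Qed.

End ParkingFunctions.

Lemma card_parking_function (n : nat) : 0 < n ->
  #|[set a : {ffun 'I_n -> 'I_n} | parking_function a]| = n.+1 ^ n.-1.
Proof.
(* All labels are still unassigned, so any function can serve as [a0]. *)
move=> n_gt0; pose a0 : {ffun 'I_n -> 'I_n} := [ffun=> Ordinal n_gt0].
have := @card_parking_completions n n 0 setT 0 a0 erefl.
rewrite cardsT card_ord addn0 => /(_ erefl).
have -> : parking_num n 0 = n.+1 ^ n.-1.
  by rewrite -(prednK n_gt0) /=; rewrite mul1n addn0.
move=> <-; apply: eq_card => a; rewrite !inE.
have -> : [forall v, if v \in [set: 'I_n] then 0 <= a v else a v == a0 v].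
  by apply/forallP=> v; rewrite inE.
apply: eq_forallb => i; rewrite subn0 add0n /=; congr (_ < #|pred_of_set _|).
by apply/setP=> v; rewrite !inE.
Qed.

(** * Nonnesting partitions and parking functions *)

Section Blocks.

Variable n : nat.
Local Notation T := 'I_n.
Implicit Types (a pos : {ffun T -> T}) (u v x y : T).

(** Blocks are read in decreasing order of labels, so the leftmost label of a block is its
    largest. *)
Definition block_head a v : bool := [forall x, (a x == a v) ==> (x <= v)].

(** An arc of the partition: [u], the next larger label of the block, stands to the left of [v]. *)
Definition block_next a u v : bool :=
  [&& a u == a v, v < u & [forall x, (a x == a u) ==> (v < x) ==> (u <= x)]].

Lemma block_nextP a u v : reflect
  [/\ a u = a v, v < u & forall x, a x = a u -> v < x -> u <= x]
  (block_next a u v).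
Proof.
apply: (iffP and3P) => [[/eqP auv vu /forallP min]|[auv vu min]].
  by split=> // x /eqP axu vx; have := min x; rewrite axu vx.
split=> //; first exact/eqP.
by apply/forallP=> x; apply/implyP=> /eqP axu; apply/implyP; apply: min.
Qed.

Lemma block_headPn a v :
  reflect (exists u, block_next a u v) (~~ block_head a v).
Proof.
apply: (iffP idP) => [|[u /block_nextP[auv vu _]]].
  rewrite negb_forall => /existsP[x0]; rewrite negb_imply -ltnNge => hx0.
  case: (@arg_minnP _ x0 (fun x => (a x == a v) && (v < x)) val hx0).
  move=> u /andP[/eqP auv vu] min; exists u; apply/block_nextP; split=> //.
  by move=> x axu vx; apply: min; rewrite axu auv eqxx.
by rewrite negb_forall; apply/existsP; exists u; rewrite auv eqxx -ltnNge.
Qed.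

Lemma block_head_next a u v : block_head a v -> block_next a u v -> False.
Proof. by move=> hv uv; apply/negP: hv; apply/block_headPn; exists u. Qed.

Lemma block_next_injl a u u' v : block_next a u v -> block_next a u' v -> u = u'.
Proof.
case/block_nextP=> auv vu minu /block_nextP[auv' vu' minu'].
apply/val_inj/eqP; rewrite eqn_leq minu // ?minu' //; congruence.
Qed.

Lemma block_next_injr a u v v' : block_next a u v -> block_next a u v' -> v = v'.
Proof.
case/block_nextP=> auv vu minu /block_nextP[auv' vu' minu'].
apply/val_inj; case: (ltngtP v v') => // lt_vv.
  have := minu v'; rewrite -auv' => /(_ erefl lt_vv); lia.
have := minu' v; rewrite -auv => /(_ erefl lt_vv); lia.
Qed.

Lemma exists_block_head a v : exists2 r, block_head a r & a r = a v.
Proof.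
case: (@arg_maxnP _ v (fun x => a x == a v) val (eqxx _)) => r /eqP ar max.
exists r => //; apply/forallP=> x; apply/implyP=> /eqP ax.
by apply: max; rewrite ax ar.
Qed.

(* [pos] is a linear order of the labels for which the blocks of equal value of
   [a], each read in decreasing order of labels, form a nonnesting partition,
   and [a] is the position at which the block of a label starts. *)
Definition compatible pos a : bool :=
  [&& injectiveb pos,
      [forall v, block_head a v ==> (pos v == a v)],
      [forall u, forall v, block_next a u v ==> (pos u < pos v)] &
      [forall u, forall v, forall u', forall v',
        [&& block_next a u v, block_next a u' v' & pos u < pos u']
        ==> (pos v < pos v')]].

Lemma compatibleP pos a : reflect
  [/\ injective pos,
      forall v, block_head a v -> pos v = a v,
      forall u v, block_next a u v -> pos u < pos v &
      forall u v u' v', block_next a u v -> block_next a u' v' ->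
        pos u < pos u' -> pos v < pos v']
  (compatible pos a).
Proof.
apply: (iffP and4P) => [[/injectiveP inj hd nx nn]|[inj hd nx nn]]; split=> //.
- by move=> v hv; apply/eqP; move/forallP/(_ v)/implyP: hd; apply.
- by move=> u v; move/forallP/(_ u)/forallP/(_ v)/implyP: nx.
- move=> u v u' v' uv uv' lt.
  move/forallP/(_ u)/forallP/(_ v)/forallP/(_ u')/forallP/(_ v')/implyP: nn.
  by apply; rewrite uv uv' lt.
- exact/injectiveP.
- by apply/forallP=> v; apply/implyP=> hv; apply/eqP/hd.
- by do 2!apply/forallP=> ?; apply/implyP; apply: nx.
- by do 4!apply/forallP=> ?; apply/implyP=> /and3P[]; apply: nn.
Qed.

(** * The order is determined by the parking function *)

Lemma surj_of_inj pos (i : T) : injective pos -> exists v, pos v = i.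
Proof. by case/injF_bij=> g _ gK; exists (g i). Qed.

Lemma card_pos_lt pos (i : nat) : injective pos -> i <= n ->
  #|[set v | pos v < i]| = i.
Proof.
move=> inj le_in; rewrite -(card_imset _ inj) -[RHS]card_ord.
have winj : injective (widen_ord le_in).
  by move=> x y /(congr1 val) /= /val_inj.
rewrite -(card_imset _ winj); apply: eq_card => j.
apply/imsetP/imsetP => [[v]|[k _ ->]].
  by rewrite inE => vi ->; exists (Ordinal vi) => //; apply: val_inj.
have [v vk] := surj_of_inj (widen_ord le_in k) inj.
by exists v; rewrite ?inE vk //=.
Qed.

(** Climbing from [v] to the head of its block moves left to position [a v], so [a v <= pos v].
    Hence the [i + 1] labels at positions up to [i] have value at most [i]. *)
Lemma compatible_parking pos a : compatible pos a -> parking_function a.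
Proof.
case/compatibleP=> inj hd nx nn.
have le_a v : a v <= pos v.
  have [m] := ubnP (n - v); elim: m v => // m IHm v vm.
  have [/hd-> //|/block_headPn[u uv]] := boolP (block_head a v).
  have /ltnW := nx _ _ uv; case/block_nextP: uv => <- vu _.
  by move=> /(leq_trans _)-> //; apply: IHm; have := ltn_ord u; lia.
apply/forallP=> i; have := card_pos_lt inj (ltn_ord i) => {1}<-.
apply/subset_leq_card/subsetP=> v; rewrite !inE ltnS.
exact/leq_trans/le_a.
Qed.

(** Compare the labels at the first position not yet treated. If one of them is a head, its value
    fixes its position in both orders. Otherwise their predecessors lie further left, where the
    orders agree, and nonnesting decides. *)
Lemma compatible_uniq pos pos' a :
  compatible pos a -> compatible pos' a -> pos = pos'.
Proof.
case/compatibleP=> inj hd nx nn /compatibleP[inj' hd' nx' nn'].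
(* The disjunction lets the induction hypothesis apply to a label known to be early in only one of
   the two orders. *)
suff eq_lt (m : nat) : forall v, pos v < m \/ pos' v < m -> pos v = pos' v.
  by apply/ffunP=> v; apply: (eq_lt n); left.
elim: m => [|m IHm] v0; first by case.
have [i_m|mn _] := boolP (m < n); last first.
  by apply: IHm; left; have := ltn_ord (pos v0); lia.
pose i := Ordinal i_m.
have [v vi] := surj_of_inj i inj; have [v' vi'] := surj_of_inj i inj'.
suff vv' : v = v'.
  have H (p q : {ffun T -> T}) (x : T) : injective p -> p v = i -> q v = i ->
      (p x < m -> p x = q x) -> p x < m.+1 -> p x = q x.
    move=> injp pv qv IH; rewrite ltnS leq_eqVlt => /orP[/eqP pxi|//].
    have /injp-> : p x = p v by rewrite pv; apply: val_inj.
    by rewrite pv qv.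
  have vi2 : pos' v = i by rewrite vv'.
  case=> lt_m; first by apply: H => // lt; apply: IHm; left.
  by symmetry; apply: H => // lt; symmetry; apply: IHm; right.
have [hv|/block_headPn[u uv]] := boolP (block_head a v).
  by apply: inj'; rewrite vi' hd' // -hd.
have [hv|/block_headPn[u' uv']] := boolP (block_head a v').
  by apply: inj; rewrite vi hd // -hd'.
have pu : pos u = pos' u by apply: IHm; left; have := nx _ _ uv; rewrite vi.
have pu' : pos u' = pos' u' by apply: IHm; right; have := nx' _ _ uv'; rewrite vi'.
case: (ltngtP (pos u) (pos u')) => [lt|lt|/val_inj/inj eq_u].
- have := lt; rewrite pu pu' => /(nn' _ _ _ _ uv uv'); rewrite vi' /= => ltv.
  by have := IHm v (or_intror ltv); rewrite vi => e; move: ltv; rewrite -e ltnn.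
- have := nn _ _ _ _ uv' uv lt; rewrite vi /= => ltv.
  by have := IHm v' (or_introl ltv); rewrite vi' => e; move: ltv; rewrite e ltnn.
by move: uv; rewrite eq_u => uv; apply: block_next_injr uv uv'.
Qed.

(* First-in first-out filling of the positions below [i]; labels that are not
   placed yet sit at the dummy position [n]. *)
Definition partial_filling a (i : nat) (p : T -> nat) : Prop :=
  [/\ [/\ forall v, p v < i \/ p v = n,
      forall u v, p u = p v -> p u < i -> u = v &
      #|[set v | p v < i]| = i],
      forall v, block_head a v -> (a v < i -> p v = a v) /\ (p v < i -> p v = a v),
      forall u v, block_next a u v -> p v < i -> p u < p v &
      forall u v u' v', block_next a u v -> block_next a u' v' ->
        p v' < i -> p u < p u' -> p v < p v'].

(** Bookkeeping shared by the two ways of filling position [i]: by a head, or by the next label of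
    an open block. *)
Lemma place_label (p : T -> nat) (i : nat) (v : T) :
  i < n -> p v = n -> (forall x, p x < i \/ p x = n) ->
  let p' := fun x => if x == v then i else p x in
  [/\ forall x, p' x < i.+1 -> x = v \/ (p x < i /\ p' x = p x),
      forall x, p x < i -> p' x = p x,
      p' v = i,
      (forall x y, p x = p y -> p x < i -> x = y) ->
        forall x y, p' x = p' y -> p' x < i.+1 -> x = y &
      (forall x, p' x < i.+1 \/ p' x = n) /\
      #|[set x | p' x < i.+1]| = #|[set x | p x < i]|.+1 ].
Proof.
move=> i_n pv pd p'.
have lt_p' x : p' x < i.+1 -> x = v \/ p x < i /\ p' x = p x.
  by rewrite /p'; case: eqP => [->|_]; [left|right; case: (pd x); lia].
have p'_lt x : p x < i -> p' x = p x.
  by rewrite /p'; case: eqP => [->|//]; rewrite pv; lia.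
have p'v : p' v = i by rewrite /p' eqxx.
split=> //.
- move=> inj x y e xi.
  have yi1 : p' y < i.+1 by rewrite -e.
  case: (lt_p' _ yi1) (lt_p' _ xi) => [ey|[yi ey]] [ex|[xi' ex]].
  + by rewrite ex ey.
  + by move: e; rewrite ey p'v ex; lia.
  + by move: e; rewrite ex p'v ey; lia.
  + by apply: inj; rewrite // -ex -ey.
- split; first by move=> x; rewrite /p'; case: eqP => _; [left|case: (pd x); lia].
  transitivity #|v |: [set x | p x < i]|; last first.
    by rewrite cardsU1 inE pv ltnNge (ltnW i_n).
  apply: eq_card => x; rewrite !inE /p'.
  case: (x =P v) => [_|_] /=; first by rewrite ltnSn.
  by apply/idP/idP; case: (pd x); lia.
Qed.

(** A head of value [i] must go to position [i]. If there is none, the position goes to the waiting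
    label whose predecessor was placed first. *)
Lemma partial_filling_step a i p : parking_function a -> i < n ->
  partial_filling a i p -> exists p', partial_filling a i.+1 p'.
Proof.
move=> park i_n [[pd pinj pcard] phd pnx pnn]; pose i0 := Ordinal i_n.
have [/existsP[v /andP[hv /eqP avi]]|nohead] :=
    boolP [exists v, block_head a v && (a v == i0)].
  have pv : p v = n.
    by case: (pd v) => // pvi; have [_ /(_ pvi)] := phd v hv; rewrite avi /=; lia.
  have := place_label i_n pv pd; set p' := fun x => _.
  case=> lt_p' p'_lt p'v p'inj [p'd p'card]; exists p'; split.
  - by split=> //; [exact: p'inj|rewrite p'card pcard].
  - move=> x hx; have [h1 h2] := phd x hx; split.
      rewrite ltnS leq_eqVlt => /orP[/eqP axi|axi].
        suff -> : x = v by rewrite p'v avi.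
        apply/val_inj/eqP; rewrite eqn_leq.
        move/forallP/(_ x): hv; move/forallP/(_ v): hx.
        have -> : a x = a v by rewrite avi; apply: val_inj.
        by rewrite eqxx /= => -> ->.
      by rewrite p'_lt h1.
    by case/lt_p'=> [->|[/h2 <- ->//]]; rewrite p'v avi.
  - move=> x y xy /lt_p'[ev|[yi ->]].
      by case: (block_head_next hv (u := x)); rewrite -ev.
    by have xy' := pnx _ _ xy yi; rewrite p'_lt //; apply: ltn_trans yi.
  move=> x y x' y' xy xy' /lt_p'[ev|[yi ->]].
    by case: (block_head_next hv (u := x')); rewrite -ev.
  have x'y' := pnx _ _ xy' yi; have x'i := ltn_trans x'y' yi.
  rewrite (p'_lt x') // => xx'.
  have [ev|[xi ex]] : x = v \/ p x < i /\ p' x = p x by apply: lt_p'; lia.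
    by move: xx'; rewrite ev p'v; lia.
  rewrite ex in xx'; have yy := pnn _ _ _ _ xy xy' yi xx'.
  by rewrite p'_lt //; apply: ltn_trans yi.
have no_i x : a x != i0.
  apply: contra nohead => /eqP axi; have [r hr ar] := exists_block_head a x.
  by apply/existsP; exists r; rewrite hr ar axi eqxx.
(* More than [i] labels have value at most [i], none has value [i], and only [i] labels are placed,
   so some label is waiting. *)
have [y0 hy0] : exists y, (a y < i) && (p y == n).
  apply/existsP; have := forallP park i0; apply: contraTT.
  rewrite negb_exists => /forallP none; rewrite -leqNgt /= -[X in _ <= X]pcard.
  apply/subset_leq_card/subsetP=> x; rewrite !inE => axi.
  have := none x; have := no_i x; rewrite -(inj_eq val_inj) /=; case: (pd x) => //.
  by move=> ->; rewrite eqxx; lia.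
case: (@arg_maxnP _ y0 (fun y => (a y < i) && (p y == n)) val hy0).
move=> y /andP[ayi /eqP py] ymax.
(* As [y] is the largest waiting label, its predecessor, being larger, is already placed; this makes
   [Q] below nonempty. *)
have [u0 u0y] : exists u, block_next a u y.
  apply/block_headPn/negP=> hy; have [/(_ ayi) e _] := phd _ hy.
  by move: py; rewrite e; lia.
pose Q u := (p u < i) && [exists v, block_next a u v && (p v == n)].
have Qu0 : Q u0.
  rewrite /Q; apply/andP; split; last by apply/existsP; exists y; rewrite u0y py eqxx.
  case/block_nextP: u0y => au yu _; case: (pd u0) => // pu.
  by have := ymax u0; rewrite au ayi pu eqxx /= => /(_ isT); lia.
case: (@arg_minnP _ u0 Q p Qu0) => u /andP[ui /existsP[v /andP[uv /eqP pv]]] umin.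
have := place_label i_n pv pd; set p' := fun x => _.
case=> lt_p' p'_lt p'v p'inj [p'd p'card]; exists p'; split.
- by split=> //; [exact: p'inj|rewrite p'card pcard].
- move=> x hx; have [h1 h2] := phd x hx; split.
    rewrite ltnS leq_eqVlt => /orP[axi|axi]; last by rewrite p'_lt h1.
    by have := no_i x; rewrite -(inj_eq val_inj) /= axi.
  by case/lt_p'=> [ev|[/h2 <- ->//]]; case: (block_head_next hx (u := u)); rewrite ev.
- move=> x z xz /lt_p'[ev|[zi ->]].
    by move: xz; rewrite ev => /block_next_injl/(_ uv) ->; rewrite p'v p'_lt.
  by have xz' := pnx _ _ xz zi; rewrite p'_lt //; apply: ltn_trans zi.
move=> x z x' z' xz xz' /lt_p'[ev|[zi ->]].
  move: xz'; rewrite ev => /block_next_injl/(_ uv) ->; rewrite p'v (p'_lt u) // => xu.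
  have [ex|[xi ex]] : x = v \/ p x < i /\ p' x = p x by apply: lt_p'; lia.
    by move: xu; rewrite ex p'v; lia.
  have [zi|zn] := pd z; first by rewrite p'_lt.
  (* A waiting [z] would put [x] into [Q] ahead of the minimal [u]. *)
  have : Q x by rewrite /Q xi; apply/existsP; exists z; rewrite xz zn eqxx.
  by move/umin; lia.
have x'z' := pnx _ _ xz' zi; have x'i := ltn_trans x'z' zi.
rewrite (p'_lt x') // => xx'.
have [ev|[xi ex]] : x = v \/ p x < i /\ p' x = p x by apply: lt_p'; lia.
  by move: xx'; rewrite ev p'v; lia.
rewrite ex in xx'; have yy := pnn _ _ _ _ xz xz' zi xx'.
by rewrite p'_lt //; apply: ltn_trans zi.
Qed.

Lemma parking_compatible a : parking_function a -> exists pos, compatible pos a.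
Proof.
move=> park.
have [p [[pd pinj pcard] phd pnx pnn]] : exists p, partial_filling a n p.
  suff H i : i <= n -> exists p, partial_filling a i p by apply: (H n).
  elim: i => [_|i IHi i_n]; last first.
    by have [p hp] := IHi (ltnW i_n); apply: partial_filling_step hp.
  exists (fun=> n); split=> //; split=> //; first by move=> v; right.
  by apply/eqP; rewrite cards_eq0; apply/eqP/setP=> v; rewrite !inE.
(* At stage [n] the count leaves no label at the dummy position. *)
have p_n v : p v < n.
  have : [set v | p v < n] = setT.
    by apply/eqP; rewrite eqEcard subsetT cardsT card_ord pcard leqnn.
  by move/setP/(_ v); rewrite !inE.
exists [ffun v => Ordinal (p_n v)]; apply/compatibleP; split.
- by move=> u v; rewrite !ffunE => /(congr1 val) /= e; apply: pinj.
- by move=> v /phd[_ /(_ (p_n v)) e]; apply: val_inj; rewrite ffunE.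
- by move=> u v uv; rewrite !ffunE /=; apply: pnx.
- by move=> u v u' v' uv uv'; rewrite !ffunE /=; apply: pnn uv uv' _.
Qed.

Lemma card_compatible :
  #|[set z : {ffun T -> T} * {ffun T -> T} | compatible z.1 z.2]|
  = #|[set a : {ffun T -> T} | parking_function a]|.
Proof.
rewrite -(card_in_imset (f := snd)) => [|z z']; last first.
  rewrite !inE; case: z z' => [pos a] [pos' a'] /= h h' e.
  by rewrite e in h *; rewrite (compatible_uniq h h').
apply: eq_card => a; rewrite inE; apply/imsetP/idP => [[z]|].
  by rewrite inE => /compatible_parking park ->.
by case/parking_compatible=> pos h; exists (pos, a); rewrite ?inE.
Qed.

End Blocks.

(** * Parking graphs and nonnesting partitions *)

(* [path.arc] shadows the arc relation of a mixed graph. *)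
Local Notation arc := Defs.arc.

Section Graphs.

Variable n : nat.
Local Notation T := 'I_n.
Implicit Types (a pos : {ffun T -> T}) (u v x y : T) (f : mgraph n).

(** The order ideal of intervals generated by the arcs; [u] marks the left end. *)
Definition under_arc pos a u v : bool :=
  [exists x, exists y, [&& block_next a x y, pos x <= pos u & pos v <= pos y]].

Lemma under_arcP pos a u v : reflect
  (exists x y, [/\ block_next a x y, pos x <= pos u & pos v <= pos y])
  (under_arc pos a u v).
Proof.
apply: (iffP existsP) => [[x /existsP[y /and3P[*]]]|[x [y [*]]]].
  by exists x, y.
by exists x; apply/existsP; exists y; apply/and3P.
Qed.

(** Noninversions become up edges, and inversions are downish exactly in the ideal. The first branch
    provides the normalization. *)
Definition graph_of (z : {ffun T -> T} * {ffun T -> T}) : mgraph n :=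
  [ffun e : T * T =>
    if e.2 <= e.1 then Down
    else if z.1 e.1 < z.1 e.2 then Up
    else if under_arc z.1 z.2 e.2 e.1 then Downish else Down].

Lemma graph_ofE pos a u v : u < v -> graph_of (pos, a) (u, v) =
  if pos u < pos v then Up
  else if under_arc pos a v u then Downish else Down.
Proof. by move=> uv; rewrite ffunE /= leqNgt uv. Qed.

Lemma arc_graph_of pos a u v : injective pos ->
  arc (graph_of (pos, a)) u v = (pos u < pos v).
Proof.
move=> inj; rewrite /Defs.arc.
have neq x y : x < y -> (pos x < pos y) = ~~ (pos y < pos x).
  move=> xy; rewrite -leqNgt ltn_neqAle; case: eqP => //= /val_inj/inj e.
  by rewrite e ltnn in xy.
case: (ltngtP u v) => [uv|vu|/val_inj->] /=; last by rewrite ltnn.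
  by rewrite graph_ofE // orbF; case: ifP => // _; case: ifP.
rewrite graph_ofE //; have := neq _ _ vu.
by case: ifP => _; case: (pos u < pos v) => //; case: ifP.
Qed.

(** Directed edges increase [pos], so there is no cycle. If source and sink were joined by a downish
    edge, the arc above them would cover the whole triangle and leave it no down edge. *)
Lemma graph_of_parking pos a :
  compatible pos a -> parking_graph (graph_of (pos, a)).
Proof.
case/compatibleP=> inj hd nx nn; set f := graph_of _.
have arcE u v : arc f u v = (pos u < pos v) by apply: arc_graph_of.
apply/and3P; split.
- by do 2!apply/forallP=> ?; apply/implyP=> le; rewrite ffunE /= le.
- apply/forallP=> x; apply/forallP=> y; apply/implyP; rewrite arcE => xy.
  apply/negP=> /connectP[p]; elim: p y xy => [|z p IHp] y xy /=.
    by move=> _ e; rewrite e ltnn in xy.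
  by rewrite arcE => /andP[yz]; apply: IHp; apply: ltn_trans yz.
apply/forallP=> i; apply/forallP=> j; apply/forallP=> k.
apply/implyP=> /and4P[ij jk down _].
apply/forallP=> s; apply/forallP=> t; apply/implyP.
case/and5P=> sT tT _ /allP src /allP snk; apply/negP=> /eqP dsh.
have {}src x : x \in [:: i; j; k] -> pos s <= pos x.
  by move/src; rewrite arcE -leqNgt.
have {}snk x : x \in [:: i; j; k] -> pos x <= pos t.
  by move/snk; rewrite arcE -leqNgt.
have [x [y [xy xs ty]]] : exists x y,
    [/\ block_next a x y, pos x <= pos s & pos t <= pos y].
  move: dsh; rewrite /ekind; case: ifP => st.
    (* For [s < t] the edge is not up, so [pos t <= pos s] and the bounds of the arc can be
       exchanged. *)
    rewrite graph_ofE //; case: ifP => // nlt; case: ifP => // /under_arcP.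
    case=> x [y [xy xt sy]] _; exists x, y; split=> //.
      by have := src t tT; lia.
    by have := snk s sT; lia.
  rewrite ffunE /=; case: ifP => // _; case: ifP => // _.
  by case: ifP => // /under_arcP.
have nodown u v : u \in [:: i; j; k] -> v \in [:: i; j; k] -> u < v ->
    f (u, v) != Down.
  move=> uT vT uv; rewrite graph_ofE //; case: ifP => // _.
  case: ifP => // /negbT/negP[]; apply/under_arcP; exists x, y; split=> //.
    exact: leq_trans (src v vT).
  exact: leq_trans (snk u uT) _.
move: down; rewrite !inE ![Down == _]eq_sym.
have ik := ltn_trans ij jk.
by rewrite !(negbTE (nodown _ _ _ _ _)) // !inE eqxx ?orbT.
Qed.

(** * Recovering order and partition from the graph *)

(** The larger label comes first, since a downish edge is directed from it and it therefore stands
    on the left. *)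
Definition downish_pair f u v : bool := (v < u) && (f (v, u) == Downish).

Definition maximal_pair f pos u v : bool :=
  downish_pair f u v && [forall x, forall y,
    [&& downish_pair f x y, pos x <= pos u & pos v <= pos y]
      ==> (x == u) && (y == v)].

Lemma maximal_pairP f pos u v : reflect
  (downish_pair f u v /\ forall x y, downish_pair f x y ->
     pos x <= pos u -> pos v <= pos y -> x = u /\ y = v)
  (maximal_pair f pos u v).
Proof.
apply: (iffP andP) => [[duv /forallP max]|[duv max]]; split=> //.
  move=> x y dxy xu vy; have /forallP/(_ y)/implyP := max x.
  by rewrite dxy xu vy => /(_ isT)/andP[/eqP-> /eqP->].
apply/forallP=> x; apply/forallP=> y; apply/implyP=> /and3P[dxy xu vy].
by have [-> ->] := max _ _ dxy xu vy; rewrite !eqxx.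
Qed.

Lemma downish_graph_of pos a u v :
  downish_pair (graph_of (pos, a)) u v =
  [&& v < u, pos u <= pos v & under_arc pos a u v].
Proof.
rewrite /downish_pair; case vu: (v < u) => //=.
rewrite graph_ofE // [pos u <= _]leqNgt.
by case: (pos v < pos u); case: (under_arc _ _ _ _).
Qed.

(** Every downish pair lies under an arc, arcs are downish pairs themselves, and nonnesting makes
    distinct arcs incomparable. *)
Lemma maximal_pair_graph_of pos a u v : compatible pos a ->
  maximal_pair (graph_of (pos, a)) pos u v = block_next a u v.
Proof.
case/compatibleP=> inj hd nx nn.
have dnx x y : block_next a x y -> downish_pair (graph_of (pos, a)) x y.
  move=> xy; rewrite downish_graph_of (ltnW (nx _ _ xy)).
  case/block_nextP: (xy) => _ -> _ /=.
  by apply/under_arcP; exists x, y.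
apply/maximal_pairP/idP => [[duv max]|uv].
  have := duv; rewrite downish_graph_of => /and3P[_ _ /under_arcP[x [y [xy xu vy]]]].
  by have [<- <-] := max _ _ (dnx _ _ xy) xu vy.
split; first exact: dnx.
move=> u' v'; rewrite downish_graph_of => /and3P[_ _ /under_arcP[x [y [xy xu vy]]]].
move=> u'u vv'.
have eq_xu : x = u.
  have [lt|ge] := ltnP (pos x) (pos u).
    by have := nn _ _ _ _ xy uv lt; lia.
  by apply/inj/val_inj/anti_leq; rewrite ge (leq_trans xu u'u).
rewrite eq_xu in xy xu; have eq_yv := block_next_injr xy uv.
rewrite eq_yv in vy.
by split; apply/inj/val_inj/anti_leq; rewrite ?u'u ?vv' ?xu ?vy.
Qed.

(** Directed edges give the order, and maximal downish pairs give the partition. Climbing to the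
    head of a block, where [a] equals [pos], then gives [a]. *)
Lemma graph_of_inj (z z' : {ffun T -> T} * {ffun T -> T}) :
  compatible z.1 z.2 -> compatible z'.1 z'.2 ->
  graph_of z = graph_of z' -> z = z'.
Proof.
case: z z' => [pos a] [pos' a'] /= h h' eqf.
have [inj hd _ _] := compatibleP _ _ h; have [inj' hd' _ _] := compatibleP _ _ h'.
have eq_lt u v : (pos u < pos v) = (pos' u < pos' v).
  by rewrite -(arc_graph_of a) // eqf arc_graph_of.
have eq_pos : pos = pos'.
  apply/ffunP=> v; apply: val_inj => /=.
  rewrite -(card_pos_lt inj (ltnW (ltn_ord (pos v)))).
  rewrite -[RHS](card_pos_lt inj' (ltnW (ltn_ord (pos' v)))).
  by apply: eq_card => u; rewrite !inE eq_lt.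
rewrite -{}eq_pos in h' hd' eqf *; congr (_, _).
have eq_nx u v : block_next a u v = block_next a' u v.
  by rewrite -(maximal_pair_graph_of _ _ h) eqf maximal_pair_graph_of.
apply/ffunP=> v.
have [m] := ubnP (n - v); elim: m v => // m IHm v vm.
have [hv|/block_headPn[u uv]] := boolP (block_head a v).
  rewrite -hd // -hd' //; apply/negPn/negP=> /block_headPn[u].
  by rewrite -eq_nx; apply: block_head_next.
have := uv; rewrite eq_nx => /block_nextP[<- vu _].
case/block_nextP: uv => <- _ _; apply: IHm; have := ltn_ord u; lia.
Qed.

(** * The linear order of a parking graph *)

Section FromGraph.

Variable f : mgraph n.
Hypothesis park : parking_graph f.

Lemma arc_total u v : u != v -> arc f u v || arc f v u.
Proof.
rewrite -(inj_eq val_inj) /= /Defs.arc.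
by case: (ltngtP u v) => //= _ _; case: (_ == Up).
Qed.

Lemma arc_asym u v : arc f u v -> ~~ connect (arc f) v u.
Proof. by case/and3P: park => _ /forallP/(_ u)/forallP/(_ v)/implyP. Qed.

Lemma arc_irrefl u : arc f u u = false.
Proof. by rewrite /Defs.arc !ltnn. Qed.

Lemma arc_trans : transitive (arc f).
Proof.
move=> v u w uv vw; case: (eqVneq u w) => [uw|/arc_total/orP[//|wu]].
  by have /negP[] := arc_asym uv; apply: connect1; rewrite uw.
have /negP[] := arc_asym wu; apply: connect_trans (connect1 uv) (connect1 vw).
Qed.

Lemma card_in_arc v : #|[set u | arc f u v]| < n.
Proof.
rewrite -[X in _ < X]card_ord -cardsT; apply/proper_card/properP.
by split; [apply: subsetT|exists v; rewrite !inE ?arc_irrefl].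
Qed.

(** In a transitive tournament the in-degree is the position in the linear order. *)
Definition arc_pos : {ffun T -> T} := [ffun v => Ordinal (card_in_arc v)].

Lemma arc_arc_pos u v : arc f u v = (arc_pos u < arc_pos v).
Proof.
have mono x y : arc f x y -> arc_pos x < arc_pos y.
  move=> xy; rewrite !ffunE /=; apply/proper_card/properP; split.
    by apply/subsetP=> z; rewrite !inE => /arc_trans; apply.
  by exists x; rewrite !inE ?arc_irrefl.
apply/idP/idP; first exact: mono.
have [->|/arc_total/orP[//|/mono]] := eqVneq u v; first by rewrite ltnn.
by move/ltnW; rewrite leqNgt => /negbTE->.
Qed.

Lemma arc_pos_inj : injective arc_pos.
Proof.
move=> u v e; apply/eqP/negPn/negP=> /arc_total.
by rewrite !arc_arc_pos e ltnn.
Qed.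

(** * The ideal of downish pairs and its maximal elements *)

Local Notation d := (downish_pair f).
Local Notation e := (maximal_pair f arc_pos).

Lemma edge_UpE u v : u < v -> (f (u, v) == Up) = (arc_pos u < arc_pos v).
Proof. by move=> uv; rewrite -arc_arc_pos /Defs.arc uv /= ltnNge (ltnW uv) orbF. Qed.

Lemma downish_pair_pos u v : d u v -> arc_pos u < arc_pos v.
Proof.
case/andP=> vu /eqP fvu; rewrite -arc_arc_pos /Defs.arc vu fvu /=.
by rewrite orbT.
Qed.

(** With [x] strictly between them, [u] and [v] are source and sink of the triangle and joined by a
    downish edge, so the source-sink condition excludes down edges. *)
Lemma triangle_no_down u x v y z : d u v ->
  arc_pos u < arc_pos x -> arc_pos x < arc_pos v ->
  y \in [:: u; x; v] -> z \in [:: u; x; v] -> y < z -> f (y, z) != Down.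
Proof.
move=> duv ux xv yT zT yz; apply/negP=> /eqP fyz.
have uv := downish_pair_pos duv; have /andP[vu /eqP fvu] := duv.
(* [triangle_ok] speaks of increasing labels; [i], [j], [k] is the sorted triangle. *)
have tri (i j k : T) : i < j -> j < k -> [:: u; x; v] =i [:: i; j; k] -> False.
  move=> ij jk eqT; case/and3P: park => _ _.
  move/forallP/(_ i)/forallP/(_ j)/forallP/(_ k).
  have ik := ltn_trans ij jk.
  have edge (p q : T) : p \in [:: u; x; v] -> q \in [:: u; x; v] -> p < q ->
      f (p, q) \in [:: f (i, j); f (i, k); f (j, k)].
    rewrite !eqT !inE => /or3P[]/eqP-> /or3P[]/eqP->;
      rewrite ?ltnn ?eqxx ?orbT // => lt; lia.
  have -> : Down \in [:: f (i, j); f (i, k); f (j, k)] by rewrite -fyz edge.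
  have -> : Downish \in [:: f (i, j); f (i, k); f (j, k)].
    by rewrite -fvu edge // !inE eqxx ?orbT.
  rewrite ij jk /= => /forallP/(_ u)/forallP/(_ v)/implyP ok.
  have sk : all (fun w => ~~ arc f w u) [:: u; x; v].
    by rewrite /= !arc_arc_pos -!leqNgt leqnn (ltnW ux) (ltnW uv).
  have tk : all (fun w => ~~ arc f v w) [:: u; x; v].
    by rewrite /= !arc_arc_pos -!leqNgt leqnn (ltnW xv) (ltnW uv).
  suff /ok : [&& u \in [:: i; j; k], v \in [:: i; j; k], u != v,
      all (fun w => ~~ arc f w u) [:: i; j; k] &
      all (fun w => ~~ arc f v w) [:: i; j; k]].
    by rewrite /ekind ltnNge (ltnW vu) /= fvu.
  apply/and5P; split.
  - by rewrite -eqT !inE eqxx.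
  - by rewrite -eqT !inE eqxx !orbT.
  - by apply: contraTneq vu => ->; rewrite ltnn.
  - by rewrite -(eq_all_r eqT).
  - by rewrite -(eq_all_r eqT).
have neq (p q : T) : arc_pos p < arc_pos q -> p != q.
  by apply: contraTneq => ->; rewrite ltnn.
(* Since [v < u], three label orders remain: [x] above both, below both, or between. *)
have := neq _ _ ux; rewrite -(inj_eq val_inj) neq_ltn => /orP[] /= lt.
  by apply: (tri v u x) => // w;
    rewrite !inE; case: (w == u); case: (w == x); case: (w == v).
have := neq _ _ xv; rewrite -(inj_eq val_inj) neq_ltn => /orP[] /= lt'.
  by apply: (tri x v u) => // w;
    rewrite !inE; case: (w == u); case: (w == x); case: (w == v).
by apply: (tri v x u) => // w;
    rewrite !inE; case: (w == u); case: (w == x); case: (w == v).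
Qed.

Lemma not_Up_Down_Downish u v : u < v -> arc_pos v < arc_pos u ->
  f (u, v) != Down -> d v u.
Proof.
move=> uv vu nd; rewrite /downish_pair uv /=.
have := edge_UpE uv; rewrite ltnNge (ltnW vu) /=.
by case: (f (u, v)) nd.
Qed.

Lemma downish_ideal u v u' v' : d u v -> arc_pos u <= arc_pos u' ->
  arc_pos v' <= arc_pos v -> v' < u' -> arc_pos u' < arc_pos v' -> d u' v'.
Proof.
have ideal_l p q r : d p q -> arc_pos p < arc_pos r -> arc_pos r <= arc_pos q ->
    r < p -> d p r.
  move=> dpq pr; rewrite leq_eqVlt => /orP[/eqP/val_inj/arc_pos_inj-> //|rq] rp.
  by apply: not_Up_Down_Downish => //;
    apply: (triangle_no_down dpq pr rq); rewrite // !inE eqxx ?orbT.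
have ideal_r p q r : d p q -> arc_pos p <= arc_pos r -> arc_pos r < arc_pos q ->
    q < r -> d r q.
  move=> dpq; rewrite leq_eqVlt => /orP[/eqP/val_inj/arc_pos_inj<- //|pr] rq qr.
  by apply: not_Up_Down_Downish => //;
    apply: (triangle_no_down dpq pr rq); rewrite // !inE eqxx ?orbT.
move=> duv uu vv vu' uv'; have /andP[vu _] := duv.
(* The interval shrinks one end at a time, through an inversion: [(u, v')] if [v' < u], and
   otherwise [(u', v)], because v < u <= v' < u'. *)
have [lt|ge] := ltnP v' u.
  by apply: (ideal_r u v') => //; apply: (ideal_l u v) => //; apply: leq_ltn_trans uv'.
apply: (ideal_l u' v) => //; apply: (ideal_r u v) => //.
  exact: leq_trans vv.
lia.
Qed.

(** A longest downish interval around the given one is maximal. Its length is measured with [n]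
    added, which keeps the subtraction exact. *)
Lemma maximal_pair_above u v : d u v ->
  exists x y, [/\ e x y, arc_pos x <= arc_pos u & arc_pos v <= arc_pos y].
Proof.
move=> duv.
pose P (p : T * T) :=
  [&& d p.1 p.2, arc_pos p.1 <= arc_pos u & arc_pos v <= arc_pos p.2].
have Puv : P (u, v) by rewrite /P /= duv !leqnn.
case: (@arg_maxnP _ (u, v) P (fun p => arc_pos p.2 + (n - arc_pos p.1)) Puv).
case=> x y /and3P[/= dxy xu vy] max; exists x, y; split=> //.
apply/maximal_pairP; split=> // x' y' dxy' x'x yy'.
have /= := max (x', y'); rewrite /P /= dxy' (leq_trans x'x xu) (leq_trans vy yy').
move=> /(_ isT) le; have := ltn_ord (arc_pos x); have := ltn_ord (arc_pos x') => *.
by split; apply/arc_pos_inj/val_inj => /=; lia.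
Qed.

(** Intervals with a common end are nested, so maximality makes them equal. *)
Lemma maximal_pair_injl u u' v : e u v -> e u' v -> u = u'.
Proof.
case/maximal_pairP=> duv max /maximal_pairP[duv' max'].
have [le|/ltnW le] := leqP (arc_pos u) (arc_pos u').
  by case: (max' u v).
by case: (max u' v).
Qed.

Lemma maximal_pair_injr u v v' : e u v -> e u v' -> v = v'.
Proof.
case/maximal_pairP=> duv max /maximal_pairP[duv' max'].
have [le|/ltnW le] := leqP (arc_pos v) (arc_pos v').
  by case: (max u v').
by case: (max' u v).
Qed.

Lemma maximal_pair_label u v : e u v -> v < u.
Proof. by case/andP=> /andP[]. Qed.

Lemma maximal_pair_pos u v : e u v -> arc_pos u < arc_pos v.
Proof. by case/andP=> /downish_pair_pos. Qed.

(** * Chains of maximal pairs as blocks *)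

(** The default [v] makes the head of a chain a fixed point. *)
Definition chain_pred v : T := odflt v [pick u | e u v].

(** Each step that moves raises the label, so [n] steps reach the fixed point. *)
Definition chain_head v : T := iter n chain_pred v.

Lemma chain_pred_maximal u v : e u v -> chain_pred v = u.
Proof.
move=> uv; rewrite /chain_pred; case: pickP => [x xv|/(_ u)]; last by rewrite uv.
exact: maximal_pair_injl xv uv.
Qed.

Lemma chain_predP v : (e (chain_pred v) v) \/
  (chain_pred v = v /\ forall u, ~~ e u v).
Proof.
rewrite /chain_pred; case: pickP => [x xv|no]; [by left|right].
by split=> // u; rewrite no.
Qed.

Lemma iter_chain_pred k v :
  v + k <= iter k chain_pred v \/
  chain_pred (iter k chain_pred v) = iter k chain_pred v.
Proof.
elim: k => [|k IHk]; first by left; rewrite addn0.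
rewrite iterS; case: (chain_predP (iter k chain_pred v)) => [ev|[fix_k _]]; last first.
  by right; rewrite !fix_k.
case: IHk => [IHk|IHk]; last by rewrite !IHk; right.
by left; have := maximal_pair_label ev; lia.
Qed.

Lemma chain_pred_head v : chain_pred (chain_head v) = chain_head v.
Proof.
by case: (iter_chain_pred n v) => //; have := ltn_ord (iter n chain_pred v); lia.
Qed.

Lemma chain_head_pred v : chain_head (chain_pred v) = chain_head v.
Proof. by rewrite /chain_head -iterSr iterS chain_pred_head. Qed.

Lemma chain_head_ge v : v <= chain_head v.
Proof.
suff le_iter k : v <= iter k chain_pred v by apply: le_iter.
elim: k => //= k IHk; apply: leq_trans IHk _.
by case: (chain_predP (iter k chain_pred v)) => [/maximal_pair_label/ltnW|[->]].
Qed.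

(** Along a chain the next label up is the least one above [x], so order by label agrees with order
    along the chain. *)
Lemma chain_next x y : chain_head x = chain_head y -> x < y ->
  exists2 u, e u x & u <= y.
Proof.
have [m] := ubnP (n - x); elim: m x y => // m IHm x y xm exy xy.
have [ux|[fx _]] := chain_predP x; last first.
  by have := chain_head_ge y; rewrite -exy /chain_head iter_fix //; lia.
exists (chain_pred x) => //; set u := chain_pred x in ux *.
have eu : chain_head u = chain_head y by rewrite chain_head_pred.
have lt_xu := maximal_pair_label ux.
rewrite leqNgt; apply/negP.
(* If [y] lay strictly between [x] and [u], climbing from [y] would either hit [u], forcing [x = y],
   or stay below [u] forever. *)
have [k] := ubnP (n - y); elim: k y xy {exy} eu => // k IHk y xy eu yk yu.
have [|w wy wu] := IHm y u _ (esym eu) yu; first by have := ltn_ord y; lia.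
have := wu; rewrite leq_eqVlt => /orP[/eqP/val_inj ewu|lt_wu].
  by move: wy; rewrite ewu => /maximal_pair_injr/(_ ux) e_xy; rewrite e_xy ltnn in xy.
have lt_yw := maximal_pair_label wy.
apply: (IHk w) => //; first exact: ltn_trans lt_yw.
  by rewrite eu -(chain_pred_maximal wy) chain_head_pred.
by have := ltn_ord w; lia.
Qed.

Definition chain_start : {ffun T -> T} := [ffun v => arc_pos (chain_head v)].

Lemma chain_start_eq u v :
  (chain_start u = chain_start v) <-> (chain_head u = chain_head v).
Proof.
rewrite [chain_start u]ffunE [chain_start v]ffunE.
by split=> [/arc_pos_inj|->].
Qed.

Lemma block_next_chain_start u v : block_next chain_start u v = e u v.
Proof.
apply/block_nextP/idP => [[/chain_start_eq euv vu min]|uv].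
  have [w wv wu] := chain_next (esym euv) vu.
  suff -> : u = w by [].
  apply/val_inj/anti_leq; rewrite wu andbT min ?maximal_pair_label //.
  by apply/chain_start_eq; rewrite euv -(chain_pred_maximal wv) chain_head_pred.
have euv : chain_head u = chain_head v.
  by rewrite -(chain_pred_maximal uv) chain_head_pred.
split; [exact/chain_start_eq|exact: maximal_pair_label|].
move=> x /chain_start_eq exu vx.
have [w wv wx] : exists2 w, e w v & w <= x by apply: chain_next; rewrite ?exu.
by rewrite (maximal_pair_injl uv wv).
Qed.

Lemma chain_start_compatible : compatible arc_pos chain_start.
Proof.
apply/compatibleP; split.
- exact: arc_pos_inj.
- move=> v hv; rewrite [RHS]ffunE; congr (arc_pos _).
  case: (chain_predP v) => [ev|[fv _]].
    by case: (block_head_next hv (u := chain_pred v)); rewrite block_next_chain_start.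
  by rewrite /chain_head iter_fix.
- by move=> u v; rewrite block_next_chain_start; apply: maximal_pair_pos.
move=> u v u' v'; rewrite !block_next_chain_start => /maximal_pairP[duv max] euv' uu'.
(* Otherwise [(u', v')] would be nested in [(u, v)], against its maximality. *)
have [//|le] := ltnP (arc_pos v) (arc_pos v').
have /maximal_pairP[_ max'] := euv'.
by have [eu _] := max' _ _ duv (ltnW uu') le; rewrite eu ltnn in uu'.
Qed.

(** An inversion is downish exactly when it lies under a maximal pair: one direction is the ideal
    property, the other the existence of a maximal pair above. *)
Lemma graph_of_chain_start : graph_of (arc_pos, chain_start) = f.
Proof.
apply/ffunP=> -[u v].
have [vu|uv] := leqP v u.
  rewrite ffunE /= vu; case/and3P: park => /forallP/(_ u)/forallP/(_ v).
  by rewrite vu => /eqP->.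
rewrite graph_ofE //; have := edge_UpE uv; case: ifP => [_ /eqP-> //|nlt nUp].
have vu : arc_pos v < arc_pos u.
  rewrite ltn_neqAle leqNgt nlt andbT; apply: contraTneq uv => /val_inj/arc_pos_inj->.
  by rewrite ltnn.
case: ifP => [/under_arcP[x [y [xy xv uy]]]|/negbT/negP no].
  rewrite block_next_chain_start in xy; have /maximal_pairP[dxy _] := xy.
  by have /andP[_ /eqP->] := downish_ideal dxy xv uy uv vu.
case fuv: (f (u, v)) nUp => [||] //= _; case: no; apply/under_arcP.
have [|x [y [exy xv uy]]] := @maximal_pair_above v u.
  by rewrite /downish_pair uv fuv.
by exists x, y; rewrite block_next_chain_start.
Qed.

End FromGraph.

(** * The bijection and the count *)

Lemma card_parking_graph :
  #|[set f : mgraph n | parking_graph f]|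
  = #|[set z : {ffun T -> T} * {ffun T -> T} | compatible z.1 z.2]|.
Proof.
rewrite -(card_in_imset (f := graph_of)); last first.
  by move=> z z'; rewrite !inE; apply: graph_of_inj.
apply: eq_card => f; rewrite inE; apply/idP/imsetP => [park|[[pos a]]].
  exists (arc_pos f, chain_start f); last by rewrite graph_of_chain_start.
  by rewrite inE; apply: chain_start_compatible.
by rewrite inE => /graph_of_parking park ->.
Qed.

End Graphs.

Theorem theorem1p4 (n : nat) : (1 <= n)%N ->
  #|[set f : mgraph n | parking_graph f]| = (n.+1 ^ n.-1)%N.
Proof.
by move=> n_gt0; rewrite card_parking_graph card_compatible card_parking_function.
Qed.
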